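(* Let $\alpha_1,\alpha_2,\alpha_3\ge 0$ and $\beta_1,\beta_2,\beta_3>0$ be real numbers. The pseudo-paradox occurs in the asymmetrical network configuration $A/A^+$ with these parameters for any total flow $Q>0$; that is, $T^+_{Eq}=T_{Eq}$ for every $Q>0$.
   Context: The network $A^+$ has nodes $a,b,c,d$ and directed links $(a,b),(b,d),(b,c),(a,c),(c,d)$ with travel times $\alpha_1+\beta_1f_{ab}$, $\alpha_2+\beta_2f_{bd}$, $\alpha_3+\beta_3f_{bc}$, $\alpha_1+\beta_1f_{ac}$, $\alpha_2+\beta_2f_{cd}$ respectively, where $f_{ij}\ge 0$ is the (real) flow on link $(i,j)$ and $\alpha_i\ge 0$, $\beta_i>0$. All traffic, of total amount $Q>0$ (real), goes from $a$ to $d$ along the paths $P_1=a-b-d$, $P_2=a-c-d$, $P_3=a-b-c-d$. The network $A$ is $A^+$ with the link $(b,c)$ removed, so its paths are $P_1,P_2$ only. A flow assigns a non-negative real amount to each path, with total $Q$; the flow on a link is the sum of the flows of the paths containing it; the travel time on a path is the sum of the travel times of its links. A path has vanishing flow if its path flow is $0$. A network is at equilibrium if all paths with non-vanishing flow have the same travel time, and every path with vanishing flow has travel time at least this common value. The equilibrium exists and is unique; its common travel time is denoted $T_{Eq}$ for $A$ and $T^+_{Eq}$ for $A^+$ (both are functions of $Q$). The pseudo-paradox is said to occur in $A/A^+$ if $T^+_{Eq}=T_{Eq}$ for an interval of values of $Q$ (as opposed to a single point); it occurs for a given $Q$ if $Q$ belongs to such a non-degenerate interval. *)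

(* Defs.v *)
From HB Require Import structures.
From mathcomp Require Import all_boot all_order all_algebra.
From mathcomp Require Import all_classical all_reals all_analysis.
From mathcomp Require Import ring lra.

Set Implicit Arguments.
Unset Strict Implicit.
Unset Printing Implicit Defensive.

Import Order.TTheory GRing.Theory Num.Theory.
Local Open Scope classical_set_scope.
Local Open Scope ring_scope.

Inductive node := na | nb | nc | nd.

Scheme Equality for node.

Lemma node_beqP : Equality.axiom node_beq.
Proof. by move=> x y; apply: (iffP idP) => [|<-]; case: x; case: y. Qed.

HB.instance Definition _ := hasDecEq.Build node node_beqP.

Definition link : Type := (node * node)%type.
Definition route : Type := seq node.

Definition route_links (p : route) : seq link := zip p (behead p).

Definition P1 : route := [:: na; nb; nd].
Definition P2 : route := [:: na; nc; nd].
Definition P3 : route := [:: na; nb; nc; nd].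

Record network (R : realType) := Network {
  links : seq link;
  link_time : link -> R -> R }.

Section Equilibrium.
Variable R : realType.
Implicit Types (N : network R) (f : route -> R) (Q T : R).

Definition remove_link N (e : link) : network R :=
  Network (rem e (links N)) (link_time N).

(* Those of the three routes from a to d all of whose links are present. *)
Definition routes N : seq route :=
  [seq p <- [:: P1; P2; P3] | all (mem (links N)) (route_links p)].

(* A flow is a function on all routes; only its values on [routes N] count. *)
Definition is_flow N Q f : Prop :=
  (forall p, p \in routes N -> 0 <= f p) /\ \sum_(p <- routes N) f p = Q.

Definition link_flow N f (e : link) : R :=
  \sum_(p <- routes N | e \in route_links p) f p.

Definition route_time N f (p : route) : R :=
  \sum_(e <- route_links p) link_time N e (link_flow N f e).

Definition common_time N f T : Prop :=
  forall p, p \in routes N ->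
    (f p != 0 -> route_time N f p = T) /\ (f p = 0 -> T <= route_time N f p).

Definition is_equilibrium N Q f : Prop :=
  is_flow N Q f /\ exists T, common_time N f T.

(* The choice operator picks the only possible value for the networks below
   and 0 < Q: see [Aplus_wf] and [A_wf]. *)
Definition T_Eq N Q : R :=
  xget 0 [set T | exists2 f, is_equilibrium N Q f & common_time N f T].

Definition well_posed N Q : Prop :=
  exists f T, [/\ is_equilibrium N Q f, common_time N f T &
    forall f' T', is_equilibrium N Q f' -> common_time N f' T' ->
      (forall p, p \in routes N -> f' p = f p) /\ T' = T].

Lemma T_Eq_spec N Q : well_posed N Q -> forall f T,
  is_equilibrium N Q f -> common_time N f T -> T_Eq N Q = T.
Proof.
move=> [f0] [T0] [_ _ uniqT] f T eqf ctf; rewrite /T_Eq; case: xgetP.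
  by move=> T' _ [f' eqf' ctf']; rewrite (uniqT _ _ eqf' ctf').2
    (uniqT _ _ eqf ctf).2.
by move=> /(_ T) []; exists f.
Qed.

Definition pseudo_paradox_at N N' Q : Prop :=
  exists I : set R,
    [/\ is_interval I, I `<=` [set q | 0 < q],
        (exists x y, [/\ I x, I y & x < y]),
        I Q & forall q, I q -> T_Eq N' q = T_Eq N q].

End Equilibrium.

Section BraessNetworks.
Variables (R : realType) (alpha1 alpha2 alpha3 beta1 beta2 beta3 : R).

Definition Aplus : network R :=
  Network [:: (na, nb); (nb, nd); (nb, nc); (na, nc); (nc, nd)]
    (fun e x => match e with
       | (na, nb) | (na, nc) => alpha1 + beta1 * x
       | (nb, nd) | (nc, nd) => alpha2 + beta2 * x
       | (nb, nc) => alpha3 + beta3 * x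
       | _ => 0
       end).

Definition A : network R := remove_link Aplus (nb, nc).

Lemma routes_Aplus : routes Aplus = [:: P1; P2; P3]. Proof. by []. Qed.

Lemma routes_A : routes A = [:: P1; P2]. Proof. by []. Qed.

Lemma Aplus_times f :
  [/\ route_time Aplus f P1 =
        alpha1 + beta1 * (f P1 + f P3) + (alpha2 + beta2 * f P1),
      route_time Aplus f P2 =
        alpha1 + beta1 * f P2 + (alpha2 + beta2 * (f P2 + f P3)) &
      route_time Aplus f P3 =
        alpha1 + beta1 * (f P1 + f P3) + (alpha3 + beta3 * f P3)
        + (alpha2 + beta2 * (f P2 + f P3))].
Proof.
split; rewrite /route_time /link_flow routes_Aplus !big_cons !big_nil /=
  ?big_cons ?big_nil /=; ring.
Qed.

Lemma A_times f :
  route_time A f P1 = alpha1 + beta1 * f P1 + (alpha2 + beta2 * f P1) /\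
  route_time A f P2 = alpha1 + beta1 * f P2 + (alpha2 + beta2 * f P2).
Proof.
split; rewrite /route_time /link_flow routes_A !big_cons !big_nil /=
  ?big_cons ?big_nil /=; ring.
Qed.

Lemma A_wf Q : 0 < beta1 -> 0 < beta2 -> 0 < Q -> well_posed A Q.
Proof.
move=> hb1 hb2 hQ.
have memA p : p \in routes A -> p = P1 \/ p = P2.
  by rewrite routes_A !inE => /orP[] /eqP ->; [left | right].
have ctE : common_time A (fun _ => Q / 2)
    (alpha1 + beta1 * (Q / 2) + (alpha2 + beta2 * (Q / 2))).
  have [t1 t2] := A_times (fun _ => Q / 2).
  by move=> p /memA[] ->; rewrite ?t1 ?t2.
exists (fun _ => Q / 2), (alpha1 + beta1 * (Q / 2) + (alpha2 + beta2 * (Q / 2))).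
split=> //.
  split; last by eexists; exact: ctE.
  split; first by move=> p _; lra.
  by rewrite routes_A !big_cons big_nil; lra.
move=> f T [[fge0 fsum] _] ct.
have := fge0 P1 isT; have := fge0 P2 isT.
have [c1 d1] := ct P1 isT; have [c2 d2] := ct P2 isT.
move: fsum c1 d1 c2 d2; have [-> ->] := A_times f.
rewrite routes_A !big_cons big_nil addr0.
move ex: (f P1) => x; move ey: (f P2) => y.
move=> sxy c1 d1 c2 d2 y0 x0.
have xy : x = y.
  have [x00|/c1 e1] := eqVneq x 0; have [y00|/c2 e2] := eqVneq y 0.
  - by rewrite x00 y00.
  - have le1 := d1 x00; have y_gt0 : 0 < y by lra.
    have := mulr_gt0 hb1 y_gt0; have := mulr_gt0 hb2 y_gt0.
    by rewrite x00 in le1 *; lra.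
  - have le2 := d2 y00; have x_gt0 : 0 < x by lra.
    have := mulr_gt0 hb1 x_gt0; have := mulr_gt0 hb2 x_gt0.
    by rewrite y00 in le2 *; lra.
  - have /eqP : (beta1 + beta2) * (x - y) = 0 by lra.
    by rewrite mulf_eq0 => /orP[] /eqP; lra.
have xQ : x = Q / 2 by lra.
split; first by move=> p /memA[] ->; rewrite ?ex ?ey -?xy.
have /c1 <- : x != 0 by apply/eqP; lra.
by rewrite xQ.
Qed.

Lemma Aplus_wf Q : 0 <= alpha3 -> 0 < beta1 -> 0 < beta2 -> 0 < beta3 ->
  0 < Q -> well_posed Aplus Q.
Proof.
move=> ha3 hb1 hb2 hb3 hQ.
have memA p : p \in routes Aplus -> [\/ p = P1, p = P2 | p = P3].
  by rewrite routes_Aplus !inE => /or3P[] /eqP ->; constructor.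
pose g (p : route) := if p == P3 then 0 else Q / 2.
have g1 : g P1 = Q / 2 by [].
have g2 : g P2 = Q / 2 by [].
have g3 : g P3 = 0 by [].
have ctE : common_time Aplus g
    (alpha1 + beta1 * (Q / 2) + (alpha2 + beta2 * (Q / 2))).
  have [t1 t2 t3] := Aplus_times g.
  move=> p /memA[] ->; rewrite ?t1 ?t2 ?t3 ?g1 ?g2 ?g3 ?addr0 //; split=> //.
    by rewrite eqxx.
  by move=> _; lra.
exists g, (alpha1 + beta1 * (Q / 2) + (alpha2 + beta2 * (Q / 2))).
split=> //.
  split; last by eexists; exact: ctE.
  split; first by move=> p _; rewrite /g; case: ifP => _; lra.
  by rewrite routes_Aplus !big_cons big_nil g1 g2 g3; lra.
move=> f T [[fge0 fsum] _] ct.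
have := fge0 P1 isT; have := fge0 P2 isT; have := fge0 P3 isT.
have [c1 d1] := ct P1 isT; have [c2 d2] := ct P2 isT.
have [c3 d3] := ct P3 isT.
move: fsum c1 d1 c2 d2 c3 d3; have [-> -> ->] := Aplus_times f.
rewrite routes_Aplus !big_cons big_nil addr0.
move ex: (f P1) => x; move ey: (f P2) => y; move ez: (f P3) => z.
move=> s c1 d1 c2 d2 c3 d3 z0 y0 x0.
have le1 : T <= alpha1 + beta1 * (x + z) + (alpha2 + beta2 * x).
  by have [/d1//|/c1 ->] := eqVneq x 0.
have le2 : T <= alpha1 + beta1 * y + (alpha2 + beta2 * (y + z)).
  by have [/d2//|/c2 ->] := eqVneq y 0.
have zE : z = 0.
  have [//|nz] := eqVneq z 0; have e3 := c3 nz.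
  have z_gt0 : 0 < z by rewrite lt_neqAle eq_sym nz.
  have bz : 0 < beta3 * z by rewrite mulr_gt0.
  have h1 : beta2 * (y + z - x) < 0 by lra.
  have h2 : beta1 * (x + z - y) < 0 by lra.
  by move: h1 h2; rewrite !pmulr_rlt0 //; lra.
rewrite {}zE in ez s c1 d1 c2 d2 c3 d3 z0 le1 le2.
have xy : x = y.
  have [x00|/c1 e1] := eqVneq x 0; have [y00|/c2 e2] := eqVneq y 0.
  - by rewrite x00 y00.
  - have y_gt0 : 0 < y by lra.
    have := mulr_gt0 hb1 y_gt0; have := mulr_gt0 hb2 y_gt0.
    by rewrite x00 in le1 *; lra.
  - have x_gt0 : 0 < x by lra.
    have := mulr_gt0 hb1 x_gt0; have := mulr_gt0 hb2 x_gt0.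
    by rewrite y00 in le2 *; lra.
  - have /eqP : (beta1 + beta2) * (x - y) = 0 by lra.
    by rewrite mulf_eq0 => /orP[] /eqP; lra.
have xQ : x = Q / 2 by lra.
split; first by move=> p /memA[] ->; rewrite ?ex ?ey ?ez -?xy.
have /c1 <- : x != 0 by apply/eqP; lra.
by rewrite xQ addr0.
Qed.

End BraessNetworks.

(* Main.v *)
Require Import Defs.
From mathcomp Require Import all_boot all_order all_algebra.
From mathcomp Require Import all_classical all_reals all_analysis.
From mathcomp Require Import lra.
Import Order.TTheory GRing.Theory Num.Theory.
Local Open Scope ring_scope.

(** Splitting the traffic equally between the routes P1 and P2, with none on
    P3, is an equilibrium of both networks: the detour uses one alpha1 and one
    alpha2 link, as P1 and P2 do, and the bridge (b,c) on top, so it costs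
    alpha3 >= 0 more.  Hence the equilibrium time is the common time of P1 and
    P2 in either network. *)

Definition half_flow (R : realType) (Q : R) (p : route) : R :=
  if p == P3 then 0 else Q / 2.

Definition half_time (R : realType) (alpha1 alpha2 beta1 beta2 Q : R) : R :=
  alpha1 + beta1 * (Q / 2) + (alpha2 + beta2 * (Q / 2)).

Lemma half_flow_ge0 (R : realType) (Q : R) p : 0 <= Q -> 0 <= half_flow R Q p.
Proof. by rewrite /half_flow; case: ifP => _; lra. Qed.

(** [P1] and [P2] each consist of one link of either cost law, so equal loads give equal times. *)
Lemma T_Eq_A (R : realType) (alpha1 alpha2 alpha3 beta1 beta2 beta3 Q : R) :
  0 < beta1 -> 0 < beta2 -> 0 < Q ->
  T_Eq (A alpha1 alpha2 alpha3 beta1 beta2 beta3) Q =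
  half_time R alpha1 alpha2 beta1 beta2 Q.
Proof.
move=> hb1 hb2 hQ; set N := A _ _ _ _ _ _.
have ct : common_time N (half_flow R Q)
    (half_time R alpha1 alpha2 beta1 beta2 Q).
  move=> p; have [t1 t2] :=
    A_times alpha1 alpha2 alpha3 beta1 beta2 beta3 (half_flow R Q).
  by rewrite routes_A !inE => /orP[] /eqP ->; rewrite ?t1 ?t2.
(* Uniqueness from [A_wf] lets this single equilibrium determine the chosen value [T_Eq]. *)
apply: (T_Eq_spec _ _ ct); first exact: A_wf.
split; last by eexists; exact: ct.
split; first by move=> p _; apply: half_flow_ge0; exact: ltW.
by rewrite routes_A !big_cons big_nil /half_flow /=; lra.
Qed.

(** With no flow on [P3], the links of [P1] and [P2] carry the same loads as in [A], while [P3]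
    takes [half_time] plus [alpha3]. *)
Lemma T_Eq_Aplus (R : realType) (alpha1 alpha2 alpha3 beta1 beta2 beta3 Q : R) :
  0 <= alpha3 -> 0 < beta1 -> 0 < beta2 -> 0 < beta3 -> 0 < Q ->
  T_Eq (Aplus alpha1 alpha2 alpha3 beta1 beta2 beta3) Q =
  half_time R alpha1 alpha2 beta1 beta2 Q.
Proof.
move=> ha3 hb1 hb2 hb3 hQ; set N := Aplus _ _ _ _ _ _.
have ct : common_time N (half_flow R Q)
    (half_time R alpha1 alpha2 beta1 beta2 Q).
  move=> p; have [t1 t2 t3] :=
    Aplus_times alpha1 alpha2 alpha3 beta1 beta2 beta3 (half_flow R Q).
  rewrite routes_Aplus !inE => /or3P[] /eqP ->; rewrite ?t1 ?t2 ?t3;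
    rewrite /half_time /half_flow /= ?addr0 //.
  (* Only [P3] is left: its flow is 0, so the equality clause is vacuous and the inequality reduces
     to [0 <= alpha3]. *)
  by split=> [|_]; [rewrite eqxx | lra].
apply: (T_Eq_spec _ _ ct); first exact: Aplus_wf.
split; last by eexists; exact: ct.
split; first by move=> p _; apply: half_flow_ge0; exact: ltW.
by rewrite routes_Aplus !big_cons big_nil /half_flow /=; lra.
Qed.

Theorem corollary5 (R : realType)
    (alpha1 alpha2 alpha3 beta1 beta2 beta3 : R)
    (ha1 : 0 <= alpha1) (ha2 : 0 <= alpha2) (ha3 : 0 <= alpha3)
    (hb1 : 0 < beta1) (hb2 : 0 < beta2) (hb3 : 0 < beta3) :
  let NA := A alpha1 alpha2 alpha3 beta1 beta2 beta3 in
  let NAplus := Aplus alpha1 alpha2 alpha3 beta1 beta2 beta3 in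
  (forall Q : R, 0 < Q -> pseudo_paradox_at NA NAplus Q) /\
  (forall Q : R, 0 < Q -> T_Eq NAplus Q = T_Eq NA Q).
Proof.
move=> NA NAplus.
have eqT (Q : R) : 0 < Q -> T_Eq NAplus Q = T_Eq NA Q.
  by move=> hQ; rewrite T_Eq_Aplus // T_Eq_A.
(* The whole positive half-line serves as the interval for every [Q]; 1 and 2 witness that it is
   non-degenerate. *)
split=> // Q hQ; exists [set q | 0 < q]%classic; split=> //.
- by move=> x y /= x0 _ z /andP[xz _]; exact: lt_le_trans xz.
- by exists 1, 2; split=> /=; lra.
Qed.
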